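(* Let $A$ be a closed symmetric operator in a Hilbert space $\mathfrak H_1$ with equal defect numbers and let $\Pi=\{\mathcal H,\Gamma_0,\Gamma_1\}$ be an ordinary boundary triplet for $A^*$. Then: (i) If $\widetilde A=\widetilde A^*$ is a minimal selfadjoint exit space extension (a linear relation) of $A$ in $\widetilde{\mathfrak H}=\mathfrak H_1\oplus\mathfrak H_2$, and $S_2=\widetilde A\cap\mathfrak H_2^2$, $T_2=\{\{P_2\varphi,P_2\varphi'\}:\{\varphi,\varphi'\}\in\widetilde A\}$, where $P_2$ is the orthogonal projection of $\widetilde{\mathfrak H}$ onto $\mathfrak H_2$, then the linear relation $\chi:\mathfrak H_2^2\to\mathcal H^2$ defined by $$\chi=\Big\{\Big\{\widehat f_2,\begin{pmatrix}\Gamma_0\widehat f_1\\-\Gamma_1\widehat f_1\end{pmatrix}\Big\}:\ \widehat f_1\oplus\widehat f_2\in\widetilde A,\ \widehat f_1\in A^*,\ \widehat f_2\in T_2\Big\}$$ is a minimal boundary relation for $S_2^*$. (ii) If $S_2$ is a simple (closed) symmetric operator in a Hilbert space $\mathfrak H_2$ and $\chi:\mathfrak H_2^2\to\mathcal H^2$ is a minimal boundary relation for $S_2^*$, then the linear relation $\widetilde A$ in $\mathfrak H_1\oplus\mathfrak H_2$ defined by $$\widetilde A=\Big\{\widehat f_1\oplus\widehat f_2\in A^*\oplus S_2^*:\ \Big\{\widehat f_2,\begin{pmatrix}\Gamma_0\widehat f_1\\-\Gamma_1\widehat f_1\end{pmatrix}\Big\}\in\chi\Big\}$$ is a minimal selfadjoint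 extension of $A$ which satisfies $\widetilde A\cap\mathfrak H_2^2=S_2$.
   Context: A linear relation from $\mathfrak H_1$ to $\mathfrak H_2$ is a linear subspace of $\mathfrak H_1\times\mathfrak H_2$; operators are identified with graphs. Write $\widehat f=\{f,f'\}$ etc.; for $\widehat f_j=\{f_j,f_j'\}\in\mathfrak H_j^2$, $\widehat f_1\oplus\widehat f_2=\{f_1\oplus f_2,f_1'\oplus f_2'\}$. $A^*$ is the adjoint linear relation of the (not necessarily densely defined) operator $A$. A selfadjoint relation $\widetilde A\supset A$ in $\mathfrak H_1\oplus\mathfrak H_2$ is a minimal extension of $A$ if it is minimal with respect to $\mathfrak H_1$: $\mathfrak H_1\oplus\mathfrak H_2=\overline{\operatorname{span}}\{\mathfrak H_1+(\widetilde A-\lambda)^{-1}\mathfrak H_1:\lambda\in\rho(\widetilde A)\}$. A symmetric relation $S$ is simple if it has no nontrivial orthogonal decomposition $S=S'\oplus S''$ corresponding to an orthogonal decomposition of the space, with $S'$ symmetric and $S''$ selfadjoint. Ordinary boundary triplet for $A^*$ (where $n_+(A)=n_-(A)$): a triplet $\{\mathcal H,\Gamma_0,\Gamma_1\}$ with $\mathcal H$ a Hilbert space, $\dim\mathcal H=n_\pm(A)$, and $\Gamma_0,\Gamma_1$ bounded linear operators from $A^*$ (graph inner product) to $\mathcal H$ such that $(f',g)-(f,g')=(\Gamma_1\widehat f,\Gamma_0\widehat g)_{\mathcal H}-(\Gamma_0\widehat f,\Gamma_1\widehat g)_{\mathcal H}$ for all $\widehat f,\widehat g\in A^*$ and $\{\Gamma_0,\Gamma_1\}:A^*\to\mathcal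 H^2$ is surjective. Boundary relation: for a closed symmetric linear relation $S$ in $\mathfrak H$, a linear relation $\Gamma:\mathfrak H^2\to\mathcal H^2$ is a boundary relation for $S^*$ if (G1) $\operatorname{dom}\Gamma$ is dense in $S^*$ and $(f',g)_{\mathfrak H}-(f,g')_{\mathfrak H}=(h',k)_{\mathcal H}-(h,k')_{\mathcal H}$ for all $\{\widehat f,\widehat h\},\{\widehat g,\widehat k\}\in\Gamma$; (G2) every $\{\widehat g,\widehat k\}\in\mathfrak H^2\times\mathcal H^2$ satisfying this identity for all $\{\widehat f,\widehat h\}\in\Gamma$ belongs to $\Gamma$. With $T=\operatorname{dom}\Gamma$, it is minimal if $\mathfrak H=\overline{\operatorname{span}}\{\ker(T-\lambda):\lambda\in\mathbb C\setminus\mathbb R\}$. *)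

(* Defs.v *)
From HB Require Import structures.
From mathcomp Require Import all_boot all_order all_algebra sesquilinear complex.
From mathcomp Require Import boolp classical_sets cardinality reals topology normedtype.

Set Implicit Arguments.
Unset Strict Implicit.
Unset Printing Implicit Defensive.

Import Order.TTheory GRing.Theory Num.Theory.
Import numFieldNormedType.Exports.

Local Open Scope ring_scope.
Local Open Scope classical_set_scope.

(* Inner products are linear in the first argument and conjugate-linear in the
   second. *)
HB.mixin Record Lmodule_hasInner (R : realType) V of GRing.Lmodule R[i] V := {
  inner : {dot V for @Num.conj R[i]}
}.

#[short(type="innerProductType")]
HB.structure Definition InnerProduct (R : realType) :=
  { V of GRing.Lmodule R[i] V & Lmodule_hasInner R V }.

HB.mixin Record InnerProduct_isHilbert (R : realType) V
    of InnerProduct R V & CompleteNormedModule R[i] V := {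
  normr_inner : forall x : V, `|x| ^+ 2 = inner x x
}.

#[short(type="hilbertType")]
HB.structure Definition Hilbert (R : realType) :=
  { V of InnerProduct R V & CompleteNormedModule R[i] V
    & InnerProduct_isHilbert R V }.

(* The Hilbert direct sum and the graph inner product.  The library gives
   [U * V] the max norm, which is equivalent to the norm of this inner product,
   so the topology of [U * V] is that of the Hilbert space direct sum, although
   [U * V] is not itself a [hilbertType]. *)
Section prod_inner.
Variables (R : realType) (U V : innerProductType R).

Definition prod_inner (x y : U * V) : R[i] :=
  inner x.1 y.1 + inner x.2 y.2.

Fact prod_inner_bilinear :
  bilinear_for *%R (@Num.conj R[i] \; *%R) prod_inner.
Proof.
split=> [y|x] a u v; rewrite /prod_inner /=.
  by rewrite !linearPl /= addrACA -mulrDr.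
by rewrite !linearPr /= addrACA -mulrDr.
Qed.

HB.instance Definition _ :=
  bilinear_isBilinear.Build _ _ _ _ _ _ prod_inner prod_inner_bilinear.

Fact prod_inner_hermitian (x y : U * V) :
  prod_inner x y = (-1) ^+ false * Num.conj (prod_inner y x).
Proof.
rewrite /prod_inner rmorphD /= mul1r.
by congr (_ + _); rewrite hermitian_subproof mul1r.
Qed.

HB.instance Definition _ :=
  isHermitianSesquilinear.Build _ _ _ _ prod_inner prod_inner_hermitian.

Fact prod_inner_gt0 (x : U * V) : x != 0 -> 0 < prod_inner x x.
Proof.
have ge0 (W : innerProductType R) (w : W) : 0 <= inner w w.
  have [->|w0] := eqVneq w 0; first by rewrite linear0l.
  exact/ltW/neq0_dnorm_gt0.
case: x => u v; have [->|u0 _] := eqVneq u 0.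
  have [->|v0 _] := eqVneq v 0; first by rewrite eqxx.
  by rewrite ltr_wpDl ?ge0 // neq0_dnorm_gt0.
by rewrite ltr_pwDl ?ge0 // neq0_dnorm_gt0.
Qed.

HB.instance Definition _ := isDotProduct.Build _ _ prod_inner prod_inner_gt0.

HB.instance Definition _ :=
  Lmodule_hasInner.Build R (U * V)%type prod_inner.

End prod_inner.

Section linear_relations.
Variable R : realType.
Local Notation C := R[i].

Definition linear_subspace (V : lmodType C) (E : set V) : Prop :=
  GRing.submod_closed [in E].

Definition linear_span (V : lmodType C) (E : set V) : set V :=
  smallest (@linear_subspace V) E.

(* A linear relation from [U] to [V] is a [linear_subspace] of [U * V]. *)
Definition rel_dom (U V : Type) (T : set (U * V)) : set U :=
  [set f.1 | f in T].

Definition rel_operator (U V : lmodType C) (T : set (U * V)) : Prop :=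
  forall g, T (0, g) -> g = 0.

Definition rel_image (U V : Type) (T : set (U * V)) (E : set U) : set V :=
  [set g | exists2 f, E f & T (f, g)].

Definition eigenspace (V : lmodType C) (T : set (V * V)) (l : C) : set V :=
  [set f | T (f, l *: f)].

(* the relation (T - l)^-1 *)
Definition rel_resolvent (V : lmodType C) (T : set (V * V)) (l : C) :
  set (V * V) := [set (f.2 - l *: f.1, f.1) | f in T].

Definition resolvent_set (V : normedModType C) (T : set (V * V)) : set C :=
  [set l | exists2 B : {linear V -> V}, continuous B &
    rel_resolvent T l = [set f | f.2 = B f.1]].

Definition lagrange (V : innerProductType R) (f g : V * V) : C :=
  inner f.2 g.1 - inner f.1 g.2.

Definition adjoint (U V : innerProductType R) (T : set (U * V)) :
  set (V * U) := [set g | forall f, T f -> inner f.2 g.1 = inner f.1 g.2].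

Definition symmetric_relation (V : innerProductType R) (S : set (V * V)) :
  Prop := linear_subspace S /\ S `<=` adjoint S.

Definition selfadjoint_relation (V : innerProductType R) (S : set (V * V)) :
  Prop := linear_subspace S /\ S = adjoint S.

(* [S] is selfadjoint as a relation in the subspace [K] *)
Definition selfadjoint_in (V : innerProductType R) (K : set V)
    (S : set (V * V)) : Prop :=
  linear_subspace S /\ S = adjoint S `&` (K `*` K).

(* [K' = 0] is allowed: a selfadjoint relation in a nonzero space is not
   simple. *)
Definition simple_relation (V : hilbertType R) (S : set (V * V)) : Prop :=
  forall (K' K'' : set V) (S' S'' : set (V * V)),
    linear_subspace K' -> closed K' ->
    linear_subspace K'' -> closed K'' ->
    (forall x y, K' x -> K'' y -> inner x y = 0) ->
    [set x + y | x in K' & y in K''] = setT ->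
    symmetric_relation S' -> S' `<=` K' `*` K' ->
    selfadjoint_in K'' S'' ->
    S = [set f + g | f in S' & g in S''] ->
    K'' = [set 0].

Definition orthonormal_basis (V : hilbertType R) (E B : set V) : Prop :=
  [/\ B `<=` E,
      forall x y, B x -> B y -> inner x y = (x == y)%:R
    & E `<=` closure (linear_span B)].

(* equality of the Hilbert space dimensions, as cardinal numbers, of two closed
   subspaces *)
Definition hilbert_dim_eq (U V : hilbertType R) (E : set U) (F : set V) :
  Prop := exists B D,
    [/\ orthonormal_basis E B, orthonormal_basis F D & (B #= D)%card].

(* n_+(A) and n_-(A) are the dimensions of these for l = 'i and l = - 'i *)
Definition defect_space (V : innerProductType R) (A : set (V * V)) (l : C) :
  set V := eigenspace (adjoint A) l.

Definition equal_defect_numbers (V : hilbertType R) (A : set (V * V)) : Prop :=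
  hilbert_dim_eq (defect_space A 'i) (defect_space A (- 'i)).

(* Only the values on [D] matter. *)
Definition bounded_linear_on (V : innerProductType R) (H : hilbertType R)
    (D : set V) (G : V -> H) : Prop :=
  (forall a f g, D f -> D g -> G (a *: f + g) = a *: G f + G g) /\
  exists M : C, forall f, D f -> `|G f| ^+ 2 <= M * inner f f.

Record ordinary_boundary_triplet (V H : hilbertType R) (A : set (V * V))
    (G0 G1 : V * V -> H) : Prop := {
  triplet_dim_pos : hilbert_dim_eq [set: H] (defect_space A 'i) ;
  triplet_dim_neg : hilbert_dim_eq [set: H] (defect_space A (- 'i)) ;
  triplet_bounded0 : bounded_linear_on (adjoint A) G0 ;
  triplet_bounded1 : bounded_linear_on (adjoint A) G1 ;
  triplet_green : forall f g, adjoint A f -> adjoint A g ->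
    lagrange f g = inner (G1 f) (G0 g) - inner (G0 f) (G1 g) ;
  triplet_surj : forall h k : H, exists2 f, adjoint A f & G0 f = h /\ G1 f = k
}.

(* [G] is a boundary relation for the adjoint of [S]. *)
Record boundary_relation (V H : hilbertType R) (S : set (V * V))
    (G : set ((V * V) * (H * H))) : Prop := {
  boundary_base_symmetric : symmetric_relation S ;
  boundary_base_closed : closed S ;
  boundary_linear : linear_subspace G ;
  boundary_dom_sub : rel_dom G `<=` adjoint S ;
  boundary_dom_dense : adjoint S `<=` closure (rel_dom G) ;
  boundary_green : forall p q, G p -> G q ->
    lagrange p.1 q.1 = lagrange p.2 q.2 ;
  boundary_maximal : forall q,
    (forall p, G p -> lagrange p.1 q.1 = lagrange p.2 q.2) -> G q
}.

Definition minimal_boundary_relation (V H : hilbertType R) (S : set (V * V))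
    (G : set ((V * V) * (H * H))) : Prop :=
  boundary_relation S G /\
  closure (linear_span
    (\bigcup_(l in [set l : C | l \isn't Num.real])
       eigenspace (rel_dom G) l)) = [set: V].

End linear_relations.

Section exit_space.
Variables (R : realType) (H1 H2 : hilbertType R).
Local Notation C := R[i].

Definition oplus (f1 : H1 * H1) (f2 : H2 * H2) : (H1 * H2) * (H1 * H2) :=
  ((f1.1, f2.1), (f1.2, f2.2)).

Definition first_summand : set (H1 * H2) := [set u | u.2 = 0].

Definition minimal_wrt_first (At : set ((H1 * H2) * (H1 * H2))) : Prop :=
  closure (linear_span (\bigcup_(l in resolvent_set At)
    [set u + v | u in first_summand &
                 v in rel_image (rel_resolvent At l) first_summand]))
  = [set: H1 * H2].

Definition minimal_selfadjoint_extension (A : set (H1 * H1))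
    (At : set ((H1 * H2) * (H1 * H2))) : Prop :=
  [/\ selfadjoint_relation At,
      forall f, A f -> At (oplus f 0)
    & minimal_wrt_first At].

(* the intersection of [At] with the square of the second summand *)
Definition second_part (At : set ((H1 * H2) * (H1 * H2))) : set (H2 * H2) :=
  [set f2 | At (oplus 0 f2)].

(* the compression {{P_2 phi, P_2 phi'} : {phi, phi'} in At} *)
Definition second_projection (At : set ((H1 * H2) * (H1 * H2))) :
  set (H2 * H2) := [set (phi.1.2, phi.2.2) | phi in At].

Variables (H : hilbertType R) (A : set (H1 * H1)) (G0 G1 : H1 * H1 -> H).

Definition relation_of_extension (At : set ((H1 * H2) * (H1 * H2))) :
  set ((H2 * H2) * (H * H)) :=
  [set p | exists f1 f2,
    [/\ At (oplus f1 f2), adjoint A f1, second_projection At f2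
      & p = (f2, (G0 f1, - G1 f1))]].

Definition extension_of_relation (S2 : set (H2 * H2))
    (chi : set ((H2 * H2) * (H * H))) : set ((H1 * H2) * (H1 * H2)) :=
  [set phi | exists f1 f2,
    [/\ phi = oplus f1 f2, adjoint A f1, adjoint S2 f2
      & chi (f2, (G0 f1, - G1 f1))]].

End exit_space.

(* Main.v *)
From Pilot Require 
(* [lagrange] and [eigenspace] also name notions of interpolation and of matrix
   algebra. *)
Import Defs.
From HB Require Import structures.
From mathcomp Require Import all_boot all_order all_algebra sesquilinear complex ring.
From mathcomp Require Import boolp classical_sets cardinality reals topology normedtype.
From mathcomp Require Import prodnormedzmodule.

Set Implicit Arguments.
Unset Strict Implicit.
Unset Printing Implicit Defensive.

(* [lagrange] and [eigenspace] also name notions of interpolation and of matrix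
   algebra. *)
Import Defs.
Import Order.TTheory GRing.Theory Num.Theory.
Import numFieldNormedType.Exports.
Import ProdNormedZmodule.Exports.

Local Open Scope ring_scope.
Local Open Scope classical_set_scope.

(** The statement rests on one identity.  Put [b f := (G0 f, - G1 f)]; Green's
    formula for the triplet says [lagrange (b f) (b g) = - lagrange f g] on
    [adjoint A], while the Lagrange form of the exit space splits as
    [lagrange (oplus f1 f2) (oplus g1 g2) = lagrange f1 g1 + lagrange f2 g2].
    So for pairs [(f2, b f1)] and [(g2, b g1)] Green's identity of a boundary
    relation is the orthogonality of [oplus f1 f2] and [oplus g1 g2] for the
    Lagrange form.  As [b] maps [adjoint A] onto [H * H], every boundary value
    can be lifted to some [f1], and the maximality of a boundary relation
    becomes the selfadjointness of the exit space relation, in both directions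
    ([relation_of_extension_boundary], [extension_of_relation_selfadjoint]).

    Let [T] be the exit space relation, [T2] its compression to the second
    summand and [S2] its intersection with the square of that summand.  Since
    [T] is its own adjoint, [S2 = adjoint T2] ([second_part_adjoint]), so the
    density of the domain of the boundary relation and, conversely, the
    recovery of [S2] from the boundary relation are the biadjoint theorem
    ([adjoint_sub_closure]), which is the projection theorem in the Hilbert
    space [H2 * H2].

    For minimality, [T (v, u + l *: v)] with [u] in the first summand gives
    [v.2] in the eigenspace of [T2] at [l], and lifting boundary values
    produces every eigenvector in this way.  Two facts connect
    resolvents and eigenvectors.  Every nonreal [l] is in the resolvent set of a
    selfadjoint relation ([selfadjoint_resolvent_set]), again by the
    projection theorem, applied to the graph.  And since minimality of an
    extension also allows real points of the resolvent set, whereas minimality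
    of a boundary relation speaks of nonreal ones only, a limit argument is
    needed: a vector orthogonal to the resolvent vectors at nonreal points is
    orthogonal to those at real points ([real_resolvent_limit]). *)

(** * Linear subspaces and dot forms *)

Section linear_subspaces.
Context {R : realType}.
Local Notation C := R[i].

Lemma linear_subspaceP (V : lmodType C) (E : set V) :
  linear_subspace E <->
  E 0 /\ forall a u v, E u -> E v -> E (a *: u + v).
Proof.
split=> [[E0 El]|[E0 El]].
  split=> [|a u v Eu Ev]; first by rewrite inE in E0.
  by have := El a u v; rewrite !inE; apply.
by split=> [|a u v]; rewrite !inE //; exact: El.
Qed.

Lemma subspace0 (V : lmodType C) (E : set V) : linear_subspace E -> E 0.
Proof. by move=> /linear_subspaceP[]. Qed.

Lemma subspaceZ (V : lmodType C) (E : set V) a u :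
  linear_subspace E -> E u -> E (a *: u).
Proof. by move=> /linear_subspaceP[E0 El] Eu; rewrite -[_ *: _]addr0; exact: El. Qed.

Lemma subspaceD (V : lmodType C) (E : set V) u v :
  linear_subspace E -> E u -> E v -> E (u + v).
Proof. by move=> /linear_subspaceP[E0 El] Eu Ev; rewrite -[u]scale1r; exact: El. Qed.

Lemma subspaceB (V : lmodType C) (E : set V) u v :
  linear_subspace E -> E u -> E v -> E (u - v).
Proof.
move=> /linear_subspaceP[E0 El] Eu Ev.
by rewrite addrC -scaleN1r; exact: El.
Qed.

Lemma linear_span_subspace (V : lmodType C) (E : set V) :
  linear_subspace (linear_span E).
Proof.
apply/linear_subspaceP; split=> [F [/linear_subspaceP[]]//|a u v Eu Ev F [Fl EF]].
have [_] := (linear_subspaceP F).1 Fl.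
by apply; [exact: Eu|exact: Ev].
Qed.

Lemma sub_linear_span (V : lmodType C) (E : set V) : E `<=` linear_span E.
Proof. exact: sub_gen_smallest. Qed.

End linear_subspaces.

Section dot_forms.
Context {R : realType} {V : lmodType R[i]}.
Local Notation C := R[i].
Variable f : {dot V for @Num.conj C}.

Lemma dotC u v : f u v = (f v u)^*.
Proof. by rewrite hermC mul1r. Qed.

Lemma dot_ge0 u : 0 <= f u u.
Proof. exact: dnorm_ge0. Qed.

Lemma dot_real u : (f u u)^* = f u u.
Proof. exact/geC0_conj/dot_ge0. Qed.

(** Removing the component of [u] along [v] is the optimal step in the direction
    [v]; the exact gain yields both Cauchy-Schwarz and the orthogonality of
    near-minimizers below. *)
Lemma dotB_proj u v : f v v != 0 ->
  f (u - (f u v / f v v) *: v) (u - (f u v / f v v) *: v) =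
  f u u - `|f u v| ^+ 2 / f v v.
Proof.
move=> v0; rewrite dnormB dnormZ linearZr_LR /=.
rewrite !normCK !rmorphM !fmorphV /= !conjCK !dot_real.
by field.
Qed.

Lemma CauchySchwarz_dot u v : `|f u v| ^+ 2 <= f u u * f v v.
Proof.
have [->|v0] := eqVneq v 0; first by rewrite !linear0r normr0 expr0n mulr0.
have q0 : 0 < f v v by rewrite dnorm_gt0.
have := dot_ge0 (u - (f u v / f v v) *: v).
by rewrite dotB_proj ?gt_eqF// subr_ge0 ler_pdivrMr.
Qed.

End dot_forms.

(** * The projection theorem *)

(** The norm of a product is the maximum of the norms, so it is not the norm of
    the inner product of the product.  The projection theorem only needs a
    complete norm that is equivalent to the one of the form, and this property
    passes to products. *)
Record hilbert_form (R : realType) (V : normedModType R[i])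
    (f : {dot V for @Num.conj R[i]}) : Prop := {
  hilbert_complete : forall F : set_system V,
    ProperFilter F -> cauchy F -> exists l : V, F --> l ;
  hilbert_normr_le : forall x, `|x| ^+ 2 <= f x x ;
  hilbert_bounded : exists2 M, 0 < M & forall x, f x x <= M * `|x| ^+ 2
}.

Section orthogonal_projection.
Context {R : realType} {V : normedModType R[i]}.
Local Notation C := R[i].

Lemma closure_norm (E : set V) x :
  closure E x <-> forall e, 0 < e -> exists2 y, E y & `|x - y| < e.
Proof.
split=> [Ex e e0|Ex B /nbhs_ballP[e /= e0 eB]].
  have [y [Ey xy]] := Ex _ (nbhsx_ballx x e e0).
  by exists y => //; move: xy; rewrite -ball_normE.
have [y Ey xy] := Ex _ e0.
by exists y; split=> //; apply: eB; rewrite -ball_normE.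
Qed.

Lemma linear_subspace_closure (E : set V) :
  linear_subspace E -> linear_subspace (closure E).
Proof.
move=> El; apply/linear_subspaceP; split.
  by apply: subset_closure; exact: subspace0.
move=> a u v /closure_norm Eu /closure_norm Ev; apply/closure_norm => e e0.
have a0 : 0 < `|a| + 1 by rewrite ltr_wpDl.
have [u' Eu' uu'] := Eu (e / 2 / (`|a| + 1)) ltac:(by rewrite !divr_gt0).
have [v' Ev' vv'] := Ev (e / 2) ltac:(by rewrite divr_gt0).
exists (a *: u' + v'); first by apply: subspaceD => //; exact: subspaceZ.
rewrite opprD addrACA -scalerBr (splitr e) (le_lt_trans (ler_normD _ _))//.
rewrite ler_ltD// normrZ (le_trans _ (_ : (`|a| + 1) * `|u - u'| <= _))//.
  by rewrite ler_wpM2r// lerDl.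
by rewrite mulrC -ler_pdivlMr// ltW.
Qed.

Variable f : {dot V for @Num.conj C}.
Hypothesis f_hilbert : hilbert_form f.

(** By Cauchy-Schwarz and the bound on [f], the functional [f ^~ y] is
    continuous, so it vanishes at a point near which it takes arbitrarily small
    values. *)
Lemma dot_eq0_near x y :
  (forall e, 0 < e -> exists2 x', `|x - x'| < e & `|f x' y| < e) -> f x y = 0.
Proof.
move=> H; apply/eqP; rewrite -normr_le0; apply/ler_addgt0Pr => e e0.
have [M M0 fM] := hilbert_bounded f_hilbert.
pose m := M * f y y + 1.
have m0 : 0 < m by rewrite ltr_wpDl// mulr_ge0 ?dot_ge0// ltW.
pose s := sqrtC m; have s0 : 0 < s by rewrite sqrtC_gt0.
have bound z : `|f z y| <= s * `|z|.
  have sz0 : 0 <= s * `|z| by rewrite mulr_ge0 // ltW.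
  rewrite -(@ler_pXn2r _ 2) ?nnegrE// exprMn sqrtCK.
  apply: le_trans (CauchySchwarz_dot f z y) _.
  apply: le_trans (ler_wpM2r (dot_ge0 f y) (fM z)) _.
  by rewrite mulrAC ler_wpM2r ?exprn_ge0// lerDl.
have [x' xx' fx'] := H (e / (s + 1)) ltac:(by rewrite divr_gt0// addr_gt0).
rewrite add0r -[x](subrK x') linearDl.
apply: le_trans (ler_normD _ _) _.
apply: le_trans (lerD (bound _) (ltW fx')) _.
apply: le_trans (lerD (ler_wpM2l (ltW s0) (ltW xx')) (lexx _)) _.
by rewrite -[X in _ + X]mul1r -mulrDl mulrC divfK// gt_eqF// addr_gt0.
Qed.

Lemma closure_dot_eq0 (E : set V) y :
  (forall e, E e -> f e y = 0) -> forall x, closure E x -> f x y = 0.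
Proof.
move=> Ey x /closure_norm Ex; apply: dot_eq0_near => e e0.
by have [x' Ex' xx'] := Ex _ e0; exists x'; rewrite ?Ey ?normr0.
Qed.

Lemma closed_orthogonal (E : set V) :
  closed [set x | forall y, E y -> f x y = 0].
Proof.
by move=> x Ex y Ey; apply: closure_dot_eq0 Ex => z; apply.
Qed.

(** The values of [f] are complex numbers, which are only partially ordered: the
    infimum is taken over real parts. *)
Lemma infimum_dist (E : set V) x : E !=set0 ->
  exists d : C, (forall e, E e -> d <= f (x - e) (x - e)) /\
    forall t, 0 < t -> exists2 e, E e & f (x - e) (x - e) <= d + t.
Proof.
move=> [e0 Ee0].
pose q e := complex.Re (f (x - e) (x - e)).
have qE e : (q e)%:C%C = f (x - e) (x - e).
  exact/RRe_real/ger0_real/dot_ge0.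
pose D := [set q e | e in E].
have Dlb : has_inf D.
  split; first by exists (q e0), e0.
  by exists 0 => _ [e Ee <-]; rewrite -lecR qE dot_ge0.
exists (inf D)%:C%C; split=> [e Ee|t t0].
  by rewrite -qE lecR; apply: ge_inf; [exact: Dlb.2|exists e].
have tR : (complex.Re t)%:C%C = t by exact/RRe_real/gtr0_real.
have : 0 < complex.Re t by rewrite -ltcR tR.
move=> /(inf_adherent)-/(_ _ Dlb)[_ [e Ee <-]] et.
by exists e => //; rewrite -qE -tR -rmorphD lecR ltW.
Qed.

(** Moving from [y] along [h] cannot reduce the square distance by more than the
    slack [t], whereas the optimal step reduces it by [`|f y h| ^+ 2 / f h h]. *)
Lemma near_minimizer_orthogonal (d t : C) (y h : V) :
  (forall a, d <= f (y - a *: h) (y - a *: h)) -> f y y <= d + t ->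
  `|f y h| ^+ 2 <= t * f h h.
Proof.
move=> dmin yd; have [->|h0] := eqVneq h 0.
  by rewrite !linear0r normr0 expr0n mulr0.
have q0 : 0 < f h h by rewrite dnorm_gt0.
have := dmin (f y h / f h h); rewrite dotB_proj ?gt_eqF//.
move=> dm; rewrite -ler_pdivrMr// -(lerD2l d).
by apply: le_trans yd; rewrite -lerBrDr.
Qed.

(** The parallelogram identity: the midpoint of [e] and [e'] is in [E] too, so
    its distance to [x] is bounded below by [d]. *)
Lemma near_minimizers_close (E : set V) x d t e e' :
  linear_subspace E ->
  (forall e, E e -> d <= f (x - e) (x - e)) -> E e -> E e' ->
  f (x - e) (x - e) <= d + t -> f (x - e') (x - e') <= d + t ->
  f (e - e') (e - e') <= 4 * t.
Proof.
move=> El dmin Ee Ee' et e't.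
have := dmin (2^-1 *: (e + e')) (subspaceZ _ El (subspaceD El Ee Ee')).
have -> : x - 2^-1 *: (e + e') = 2^-1 *: ((x - e) + (x - e')).
  rewrite addrACA -opprD -mulr2n -[x *+ 2]scaler_nat scalerBr scalerA.
  by rewrite mulVf ?pnatr_eq0// scale1r.
have -> : e - e' = (x - e') - (x - e) by rewrite opprB [RHS]addrC addrA subrK.
move: (x - e) (x - e') et e't => u v ut vt {e e' Ee Ee'}.
rewrite dnormZ normfV normr_nat exprVn -natrX mulrC ler_pdivlMr// => duv.
have parallelogram :
    f (v - u) (v - u) = 2 * (f u u + f v v) - f (u + v) (u + v).
  by rewrite [u + v]addrC dnormB dnormD; ring.
rewrite parallelogram lerBlDr.
apply: le_trans (ler_wpM2l _ (lerD ut vt)) _ => //.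
have -> : 2 * (d + t + (d + t)) = 4 * t + d * 4 by ring.
by rewrite lerD2l.
Qed.

(** The sets of near-minimizers of the distance from [x] to [E] generate a Cauchy
    filter.  Its limit [l] is the projection: [x - l] is a limit of the
    [x - z], and these are nearly orthogonal to [E]. *)
Lemma orthogonal_projection (E : set V) x :
  linear_subspace E -> closed E ->
  exists2 e, E e & forall h, E h -> f (x - e) h = 0.
Proof.
move=> El Ec; have E0 := subspace0 El.
have [d [dmin dapprox]] : exists d : C,
    (forall e, E e -> d <= f (x - e) (x - e)) /\
    forall t, 0 < t -> exists2 e, E e & f (x - e) (x - e) <= d + t.
  by apply: infimum_dist; exists 0.
pose N t : set V := [set e | E e /\ f (x - e) (x - e) <= d + t].
pose F : set_system V := [set B | exists2 t, 0 < t & N t `<=` B].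
have FF : ProperFilter F.
  split; first by move=> [t /dapprox[e Ee et] /(_ e)]; apply; split.
  split; first by exists 1.
    move=> B B' [t t0 NB] [t' t'0 NB'].
    have Nle a b : a <= b -> N a `<=` N b.
      by move=> ab e [Ee ed]; split=> //; rewrite (le_trans ed)// lerD2l.
    have /orP[tt'|t't] := real_leVge (gtr0_real t0) (gtr0_real t'0).
      by exists t => // e Ne; split; [exact: NB|exact/NB'/(Nle _ _ tt')].
    by exists t' => // e Ne; split; [exact/NB/(Nle _ _ t't)|exact: NB'].
  by move=> B B' BB' [t t0 NB]; exists t => // e /NB/BB'.
have Fcauchy : cauchy F.
  apply: cauchy_exP => e e0.
  (* near-minimizers with slack [t] are at square distance at most [4 * t] *)
  have t0 : 0 < e ^+ 2 / 8 by rewrite divr_gt0// exprn_gt0.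
  have [u Eu ud] := dapprox _ t0.
  exists u, (e ^+ 2 / 8) => // v [Ev vd].
  rewrite -ball_normE /= -(@ltr_pXn2r _ 2) ?nnegrE// ?ltW//.
  apply: le_lt_trans (hilbert_normr_le f_hilbert _) _.
  apply: le_lt_trans (near_minimizers_close El dmin Eu Ev ud vd) _.
  have -> : 4 * (e ^+ 2 / 8) = e ^+ 2 / 2 :> C by field.
  by rewrite ltr_pdivrMr// ltr_pMr ?exprn_gt0// ltr1n.
have [l Fl] := hilbert_complete f_hilbert FF Fcauchy.
have FlE t e : 0 < t -> 0 < e -> exists2 z, N t z & `|l - z| < e.
  move=> t0 e0; have [t' t'0 Nball] := Fl _ (nbhsx_ballx l e e0).
  have : F (N t `&` ball l e) by apply: filterI; [exists t|exists t'].
  by move=> /filter_ex[z [Nz]]; rewrite -ball_normE => lz; exists z.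
exists l => [|h Eh].
  rewrite (closure_id E).1//; apply/closure_norm => e e0.
  by have [z [Ez _] lz] := FlE 1 e ltr01 e0; exists z.
apply: dot_eq0_near => e e0.
have q1 : 0 < f h h + 1 by rewrite ltr_wpDl// dot_ge0.
have t0 : 0 < e ^+ 2 / (f h h + 1) by rewrite divr_gt0// exprn_gt0.
have [z [Ez zd] lz] := FlE _ _ t0 e0.
exists (x - z); first by rewrite opprB addrC subrKA distrC.
have dz a : d <= f (x - z - a *: h) (x - z - a *: h).
  by rewrite -addrA -opprD; exact/dmin/(subspaceD El Ez)/(subspaceZ _ El).
rewrite -(@ltr_pXn2r _ 2) ?nnegrE// ?ltW//.
apply: le_lt_trans (near_minimizer_orthogonal dz zd) _.
by rewrite mulrAC ltr_pdivrMr// ltr_pM2l ?exprn_gt0// ltrDl.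
Qed.

Lemma double_orthogonal (E : set V) x : linear_subspace E ->
  (forall y, (forall e, E e -> f e y = 0) -> f x y = 0) -> closure E x.
Proof.
move=> El Exy; have [e Ee xe] :=
  orthogonal_projection x (linear_subspace_closure El) (@closed_closure _ E).
suff /eqP : f (x - e) (x - e) = 0.
  by rewrite dnorm_eq0 subr_eq0 => /eqP ->.
have ey h : closure E h -> f h (x - e) = 0.
  by move=> /xe; rewrite dotC => /eqP; rewrite fmorph_eq0 => /eqP.
rewrite linearBl [X in _ - X]ey// subr0; apply: Exy => h Eh.
exact/ey/subset_closure.
Qed.

Lemma dense_linear_span (E : set V) :
  (forall y, (forall e, E e -> f e y = 0) -> y = 0) ->
  closure (linear_span E) = setT.
Proof.
move=> Ey; rewrite -subTset => x _.
apply: double_orthogonal; first exact: linear_span_subspace.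
move=> y spany; suff -> : y = 0 by exact: linear0r.
by apply: Ey => e Ee; apply: spany; exact: sub_linear_span.
Qed.

Lemma orthogonal_dense (E : set V) y : closure (linear_span E) = setT ->
  (forall e, E e -> f e y = 0) -> y = 0.
Proof.
move=> Edense Ey; apply/eqP; rewrite -(dnorm_eq0 f); apply/eqP.
have: closure (linear_span E) y by rewrite Edense.
apply: closure_dot_eq0. apply: (@smallest_sub _ _ _ [set z | f z y = 0]) => //.
apply/linear_subspaceP; split=> [|a u v /= uy vy].
  exact: linear0l.
by rewrite linearPl /= uy vy mulr0 addr0.
Qed.


End orthogonal_projection.

(** * Products of Hilbert spaces *)

Lemma hilbert_form_inner (R : realType) (H : hilbertType R) :
  hilbert_form (inner : {dot H for @Num.conj R[i]}).
Proof.
split=> [F FF Fc|x|]; first by exists (lim F); exact: cauchy_cvg.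
  by rewrite normr_inner.
by exists 1 => // x; rewrite mul1r normr_inner.
Qed.

Lemma prod_complete (R : realType) (U V : normedModType R[i]) :
  (forall F : set_system U,
    ProperFilter F -> cauchy F -> exists l : U, F --> l) ->
  (forall F : set_system V,
    ProperFilter F -> cauchy F -> exists l : V, F --> l) ->
  forall F : set_system (U * V), ProperFilter F -> cauchy F ->
    exists l : (U * V)%type, F --> l.
Proof.
move=> Uc Vc F FF /cauchyP Fc.
have F1 : cauchy (fst @ F).
  apply: cauchy_exP => e /Fc[x Fx]; exists x.1.
  by apply: (@filterS _ F _ (ball x e)) => // y [].
have F2 : cauchy (snd @ F).
  apply: cauchy_exP => e /Fc[x Fx]; exists x.2.
  by apply: (@filterS _ F _ (ball x e)) => // y [].
have [l1 Fl1] := Uc _ _ F1.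
have [l2 Fl2] := Vc _ _ F2.
exists (l1, l2).
move=> B /(cvg_pair Fl1 Fl2) FB.
by apply: (@filterS _ F _ _ _ _ FB) => -[].
Qed.

Lemma hilbert_form_prod (R : realType) (U V : normedModType R[i])
    (f : {dot U for @Num.conj R[i]}) (g : {dot V for @Num.conj R[i]})
    (h : {dot (U * V)%type for @Num.conj R[i]}) :
  (forall x y, h x y = f x.1 y.1 + g x.2 y.2) ->
  hilbert_form f -> hilbert_form g -> hilbert_form h.
Proof.
move=> hE [fc fn [M M0 fM]] [gc gn [N N0 gN]].
have max_real (x : U * V) : (`|x.1| >=< `|x.2|).
  by rewrite real_comparable// normr_real.
split=> [|x|]; first exact: prod_complete.
  rewrite hE prod_normE; case: (comparable_leP (max_real x)) => _.
    by rewrite (le_trans (gn _))// lerDr dot_ge0.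
  by rewrite (le_trans (fn _))// lerDl dot_ge0.
exists (M + N) => [|x]; first exact: addr_gt0.
rewrite hE mulrDl lerD//.
  apply: le_trans (fM _) _; rewrite ler_wpM2l ?(ltW M0)//.
  rewrite ler_pXn2r ?nnegrE// prod_normE.
  by case: (comparable_leP (max_real x)).
apply: le_trans (gN _) _; rewrite ler_wpM2l ?(ltW N0)//.
rewrite ler_pXn2r ?nnegrE// prod_normE.
by case: (comparable_leP (max_real x)) => // /ltW.
Qed.

Section product_forms.
Context {R : realType}.
Implicit Types H K : hilbertType R.

Lemma hilbert_form_prod_inner H K :
  hilbert_form (inner : {dot (H * K)%type for @Num.conj R[i]}).
Proof.
exact: hilbert_form_prod (hilbert_form_inner H) (hilbert_form_inner K).
Qed.

Lemma hilbert_form_prod_inner2 H K :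
  hilbert_form (inner : {dot ((H * K) * (H * K))%type for @Num.conj R[i]}).
Proof.
have W_hilbert := hilbert_form_prod_inner H K.
exact: (hilbert_form_prod _ W_hilbert W_hilbert).
Qed.

End product_forms.

(** * Resolvents of symmetric and selfadjoint relations *)

Lemma rel_resolventP (R : realType) (V : lmodType R[i]) (T : set (V * V)) l u v :
  rel_resolvent T l (u, v) <-> T (v, u + l *: v).
Proof.
split=> [[[x x'] /= Tx [<- <-]]|Tv]; first by rewrite subrK.
by exists (v, u + l *: v); rewrite //= addrK.
Qed.

Section lagrange_identities.
Context {R : realType} {V : innerProductType R}.
Local Notation C := R[i].
Implicit Types (f g : V * V) (T : set (V * V)).

(** The adjoint is the image of the orthogonal complement under a rotation
    ([adjoint_orthogonal]); this reduces statements about adjoints to statements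
    about orthogonality in [V * V]. *)
Definition symplectic_rotation f : V * V := (- f.2, f.1).

Lemma lagrange_dot f g : lagrange f g = inner f (symplectic_rotation g).
Proof. by rewrite /lagrange {2}/inner/= /prod_inner/= linearNr addrC. Qed.

Lemma lagrangeC f g : lagrange f g = - (lagrange g f)^*.
Proof.
by rewrite /lagrange (dotC inner f.2) (dotC inner f.1) -rmorphB -rmorphN opprB.
Qed.

Lemma adjoint_lagrange T g : adjoint T g <-> forall f, T f -> lagrange f g = 0.
Proof.
split=> Tg f /Tg; first by rewrite /lagrange => ->; rewrite subrr.
by move/eqP; rewrite subr_eq0 => /eqP.
Qed.

Lemma lagrange_eq0C f g : lagrange f g = 0 -> lagrange g f = 0.
Proof. by rewrite (lagrangeC g) => ->; rewrite rmorph0 oppr0. Qed.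

Lemma adjoint_orthogonal T : adjoint T =
  [set g | forall f, [set symplectic_rotation f | f in T] f -> inner g f = 0].
Proof.
apply/seteqP; split=> g /=; rewrite adjoint_lagrange.
  by move=> Tg _ [f Tf <-]; rewrite -lagrange_dot; exact/lagrange_eq0C/Tg.
move=> gT f Tf; apply: lagrange_eq0C; rewrite lagrange_dot.
by apply: gT; exists f.
Qed.

Lemma adjoint_subspace T : linear_subspace (adjoint T).
Proof.
apply/linear_subspaceP; split=> [f _|a u v uT vT f Tf].
  by rewrite !linear0r.
by rewrite !linearPr /= (uT f Tf) (vT f Tf).
Qed.

(** As [inner (g + l *: x) x] is real, the difference of [inner x g] and
    [inner g x] is [2 * 'i * 'Im l * inner x x].  The claim is then the
    nonnegativity of the square norm of [g + ('i * 'Im l) *: x], which equals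
    [inner g g - 'Im l ^+ 2 * inner x x]. *)
Lemma symmetric_resolvent_bound T (g x : V) (l : C) :
  T `<=` adjoint T -> T (x, g + l *: x) ->
  'Im l ^+ 2 * inner x x <= inner g g.
Proof.
move=> Tsym Tx; have := Tsym _ Tx _ Tx.
rewrite /= linearDl linearDr linearZl_LR linearZr_LR /= => E.
have gx : inner x g = inner g x + 2 * 'i * 'Im l * inner x x.
  have -> : 2 * 'i * 'Im l = l - l^*.
    rewrite {2 3}[l]Crect rmorphD rmorphM /= conjCi.
    by rewrite !conj_Creal ?Creal_Re ?Creal_Im//; ring.
  by rewrite mulrBl addrA E addrK.
have := dot_ge0 inner (g + ('i * 'Im l) *: x).
rewrite dnormD dnormZ linearZr_LR /= normrM normCi mul1r.
rewrite !rmorphM /= !conjCK -(dotC inner) gx conjCi conj_Creal ?Creal_Im//.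
rewrite real_normK ?Creal_Im// => posq; rewrite -subr_ge0.
have -> : inner g g - 'Im l ^+ 2 * inner x x = inner g g +
    'Im l ^+ 2 * inner x x + 2 * 'i ^+ 2 * ('Im l ^+ 2 * inner x x).
  by rewrite sqrCi; ring.
by congr (0 <= _): posq; ring.
Qed.

(** This is the symmetry of the resolvent at a real point, without assuming that
    the resolvent is an operator. *)
Lemma symmetric_resolventC T (g h x y : V) (l : C) :
  T `<=` adjoint T -> l \is Num.real -> T (x, g + l *: x) -> T (y, h + l *: y) ->
  inner g y = inner x h.
Proof.
move=> Tsym lreal Tx Ty; have := Tsym _ Ty _ Tx.
rewrite /= linearDl linearDr linearZl_LR linearZr_LR /= conj_Creal//.
exact: addIr.
Qed.

(** The relation in the conclusion is [(T - a) / b]; it moves the spectral point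
    [a + 'i * b] of [T] to ['i]. *)
Lemma selfadjoint_affine T (a b : C) :
  a \is Num.real -> b \is Num.real -> b != 0 -> selfadjoint_relation T ->
  selfadjoint_relation [set p : V * V | T (p.1, a *: p.1 + b *: p.2)].
Proof.
move=> /conj_Creal aR /conj_Creal bR b0 [Tl TE]; set E := [set p | _].
have TE1 f : T f -> E (f.1, b^-1 *: (f.2 - a *: f.1)).
  by case: f => f f' Tf; rewrite /E /= scalerA divff// scale1r addrC subrK.
suff EE : E = adjoint E by split=> //; rewrite EE; exact: adjoint_subspace.
apply/seteqP; split=> g Eg.
  move=> e Ee; have : adjoint T (g.1, a *: g.1 + b *: g.2) by rewrite -TE.
  move=> /(_ _ Ee) /=.
  rewrite !linearDr !linearDl /= !linearZr_LR !linearZl_LR /= aR bR.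
  by move=> /addrI/(mulfI b0).
rewrite /E /= TE => f Tf /=.
have := Eg _ (TE1 f Tf); rewrite /= linearZl_LR linearBl linearZl_LR /=.
rewrite linearDr !linearZr_LR /= aR bR => <-.
by field.
Qed.

(** The orthogonal complement of the graph [T] is its rotated adjoint, so
    projecting [(0, g)] on [T] gives [(0, g) = (k, k') + (- k, m)] with both
    [(k, k')] and [(m, k)] in [T].  Then [(k, k') + 'i *: (m, k)] is the pair
    that is sought, as [k' + m = g]. *)
Lemma selfadjoint_range_i T (g : V) : selfadjoint_relation T ->
  (exists2 k, T k & forall h, T h -> inner ((0, g) - k) h = 0) ->
  exists x, T (x, g + 'i *: x).
Proof.
move=> [Tl TE] [[k k'] Tk kperp].
have Tm : T (g - k', k).
  rewrite TE => h /kperp; rewrite /inner /= /prod_inner /= sub0r linearNl addrC.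
  move=> /eqP; rewrite subr_eq0 => /eqP kh.
  by rewrite (dotC inner h.2) (dotC inner h.1) kh.
exists (k + 'i *: (g - k')).
suff -> : (k + 'i *: (g - k'), g + 'i *: (k + 'i *: (g - k'))) =
  'i *: (g - k', k) + (k, k') by exact: ((linear_subspaceP T).1 Tl).2.
congr pair => /=; first by rewrite addrC.
rewrite scalerDr scalerA mulCii scaleN1r opprB.
by rewrite addrCA [g + _]addrCA subrr addr0.
Qed.

End lagrange_identities.

Section selfadjoint_resolvent.
Context {R : realType} {H K : hilbertType R}.
Local Notation C := R[i].
Local Notation W := (H * K)%type.
Implicit Types T : set (W * W).

Lemma selfadjoint_range T (l : C) (g : W) :
  selfadjoint_relation T -> l \isn't Num.real ->
  exists x, T (x, g + l *: x).
Proof.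
move=> Tsa lreal; pose b := 'Im l.
have b0 : b != 0 by apply: contraNneq lreal => /Creal_ImP.
have Esa := selfadjoint_affine (Creal_Re l) (Creal_Im l) b0 Tsa.
have Ec : closed [set p : W * W | T (p.1, 'Re l *: p.1 + b *: p.2)].
  rewrite Esa.2 adjoint_orthogonal.
  exact: closed_orthogonal (hilbert_form_prod_inner2 H K) _.
have [x Tx] := selfadjoint_range_i Esa
  (orthogonal_projection (hilbert_form_prod_inner2 H K) (0, b^-1 *: g) Esa.1 Ec).
exists x; congr (T (x, _)): Tx.
rewrite scalerDr !scalerA divff// scale1r addrCA -scalerDl; congr (_ + _ *: _).
by rewrite [b * _]mulrC -Crect.
Qed.

(** Nonreal points have full range, and the resolvent bound makes the inverse
    single valued and continuous. *)
Lemma selfadjoint_resolvent_set T (l : C) :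
  selfadjoint_relation T -> l \isn't Num.real -> resolvent_set T l.
Proof.
move=> Tsa lreal; have [Tl TE] := Tsa.
have [_ TD] := (linear_subspaceP T).1 Tl.
have Tsym : T `<=` adjoint T by rewrite -TE.
pose c := 'Im l ^+ 2.
have c0 : 0 < c.
  rewrite /c real_exprn_even_gt0 ?Creal_Im//=.
  by apply: contraNneq lreal => /Creal_ImP.
have bound x g : T (x, g + l *: x) -> inner x x <= c^-1 * inner g g.
  move=> /(symmetric_resolvent_bound Tsym).
  by rewrite ler_pdivlMl.
have inj x : T (x, l *: x) -> x = 0.
  rewrite -[l *: x]add0r => /bound; rewrite linear0r mulr0 => x0.
  by apply/eqP; rewrite -(dnorm_eq0 inner) eq_le x0 dot_ge0.
have [B TB] := choice (fun g => selfadjoint_range g Tsa lreal).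
have Buniq x g : T (x, g + l *: x) -> x = B g.
  move=> Tx; apply/eqP; rewrite -subr_eq0; apply/eqP/inj; rewrite scalerBr.
  have := subspaceB Tl Tx (TB g).
  by congr (T (_, _)); rewrite /= opprD addrACA subrr add0r.
have Blin : linear B.
  move=> a u v; apply/esym/Buniq; have := TD a _ _ (TB u) (TB v).
  congr (T (_, _)).
  by rewrite /= scalerDr addrACA scalerDr !scalerA mulrC.
pose BL : {linear W -> W} := HB.pack B (GRing.isLinear.Build _ _ _ _ B Blin).
exists BL.
  apply: bounded_linear_continuous; apply/linear_boundedP.
  have [_ _ [M M0 WM]] := hilbert_form_prod_inner H K.
  have cM0 : 0 <= c^-1 * M by rewrite mulr_ge0 ?invr_ge0// ltW.
  near=> r => x; have sr : sqrtC (c^-1 * M) <= r.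
    by near: r; apply: nbhs_pinfty_ge; rewrite ger0_real ?sqrtC_ge0.
  apply: le_trans (ler_wpM2r (normr_ge0 x) sr).
  rewrite -(@ler_pXn2r _ 2) ?nnegrE ?mulr_ge0 ?sqrtC_ge0// exprMn sqrtCK.
  apply: le_trans (hilbert_normr_le (hilbert_form_prod_inner H K) _) _.
  apply: le_trans (bound _ _ (TB x)) _.
  by rewrite -mulrA ler_wpM2l ?WM// invr_ge0 ltW.
apply/seteqP; split=> -[g x]; rewrite rel_resolventP /=; first exact: Buniq.
by move=> ->.
Unshelve. all: by end_near. Qed.

End selfadjoint_resolvent.

Section real_resolvent_point.
Context {R : realType} {H K : hilbertType R}.
Local Notation C := R[i].
Local Notation W := (H * K)%type.

(** Let [z] be the resolvent of [u] at [l + 'i * e].  The difference [z - v] is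
    the resolvent at [l] of ['i * e *: z]; pairing it with [x], whose resolvent
    at [l] is [w], and using symmetry gives
    [inner v x = - ('i * e * inner z w)].  The resolvent bound keeps [z] bounded,
    so the right-hand side tends to [0] with [e]. *)
Lemma real_resolvent_limit (T : set (W * W)) (l : C) (u v x w : W) :
  selfadjoint_relation T -> l \is Num.real ->
  T (v, u + l *: v) -> T (w, x + l *: w) ->
  (forall m z, m \isn't Num.real -> T (z, u + m *: z) -> inner z x = 0) ->
  inner v x = 0.
Proof.
move=> Tsa lreal Tv Tw zx; have [Tl TE] := Tsa.
have Tsym : T `<=` adjoint T by rewrite -TE.
pose s := sqrtC (inner v v * inner w w).
have s0 : 0 <= s by rewrite sqrtC_ge0 mulr_ge0 ?dot_ge0.
have small e : 0 < e -> `|inner v x| <= e * (s + `|inner v w|).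
  move=> e0; have eR : e \is Num.real by exact: gtr0_real.
  pose m := l + 'i * e.
  have Imm : 'Im m = e by exact: Im_rect.
  have mreal : m \isn't Num.real.
    by apply/negP => /Creal_ImP; rewrite Imm => /eqP; rewrite gt_eqF.
  have [z Tz] := selfadjoint_range u Tsa mreal.
  have Tzv : T (z - v, ('i * e) *: v + m *: (z - v)).
    have := subspaceB Tl Tz Tv; congr (T (_, _)) => /=.
    rewrite opprD addrACA subrr add0r scalerBr addrCA; congr (_ + _).
    by rewrite -scalerBl -scaleNr /m; congr (_ *: _); ring.
  have zv : inner (z - v) (z - v) <= inner v v.
    have := symmetric_resolvent_bound Tsym Tzv.
    rewrite dnormZ normrM normCi mul1r Imm real_normK//.
    by rewrite ler_pM2l// exprn_gt0.
  have vx : inner v x = - ('i * e * inner z w).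
    have Tzv' : T (z - v, ('i * e) *: z + l *: (z - v)).
      congr (T (_, _)): Tzv; rewrite /m scalerDl addrCA addrC -scalerDr.
      by rewrite addrCA subrr addr0.
    have := symmetric_resolventC Tsym lreal Tzv' Tw.
    rewrite linearZl_LR linearBl [X in _ = X - _](zx _ _ mreal Tz) sub0r => ->.
    by rewrite opprK.
  rewrite vx normrN !normrM normCi mul1r gtr0_norm// ler_wpM2l ?(ltW e0)//.
  rewrite -[z](subrK v) linearDl; apply: le_trans (ler_normD _ _) _.
  rewrite lerD2r -(@ler_pXn2r _ 2) ?nnegrE// sqrtCK.
  apply: le_trans (CauchySchwarz_dot _ _ _) _.
  by rewrite ler_wpM2r ?dot_ge0.
apply/eqP; rewrite -normr_le0; apply/ler_addgt0Pr => e e0; rewrite add0r.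
pose k := s + `|inner v w|; have k0 : 0 < k + 1 by rewrite ltr_wpDl// addr_ge0.
apply: le_trans (small (e / (k + 1)) _) _; first exact: divr_gt0.
by rewrite mulrAC ler_pdivrMr// ler_wpM2l ?(ltW e0)// lerDl.
Qed.

End real_resolvent_point.

(** * Biadjoints *)

Section adjoint_density.
Context {R : realType} {V : hilbertType R}.
Implicit Types S T : set (V * V).

(** A vector orthogonal to [T] is a rotated element of [adjoint T], hence of [S],
    and so is orthogonal to [adjoint S]: conclude by [double_orthogonal]. *)
Lemma adjoint_sub_closure S T :
  linear_subspace T -> adjoint T `<=` S -> adjoint S `<=` closure T.
Proof.
move=> Tl TS x Sx; apply: (double_orthogonal (hilbert_form_prod_inner V V) Tl).
move=> y Ty; have rotE : symplectic_rotation (y.2, - y.1) = y.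
  by rewrite /symplectic_rotation /= opprK -surjective_pairing.
rewrite -rotE -lagrange_dot; apply: lagrange_eq0C.
apply: ((adjoint_lagrange _ _).1 Sx); apply: TS.
by apply/adjoint_lagrange => f Tf; rewrite lagrange_dot rotE; exact: Ty.
Qed.

Lemma closed_adjoint T : closed (adjoint T).
Proof.
rewrite adjoint_orthogonal.
exact: closed_orthogonal (hilbert_form_prod_inner V V) _.
Qed.

Lemma adjoint_closure T : adjoint T `<=` adjoint (closure T).
Proof.
move=> g /adjoint_lagrange Tg; apply/adjoint_lagrange => f.
rewrite lagrange_dot.
apply: (closure_dot_eq0 (hilbert_form_prod_inner V V)) => e /Tg.
by rewrite lagrange_dot.
Qed.

Lemma adjointS S T : S `<=` T -> adjoint T `<=` adjoint S.
Proof. by move=> ST g Tg f /ST; exact: Tg. Qed.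

Lemma sub_biadjoint T : T `<=` adjoint (adjoint T).
Proof.
move=> f Tf; apply/adjoint_lagrange => g /adjoint_lagrange Tg.
exact/lagrange_eq0C/Tg.
Qed.

Lemma biadjoint_closed S :
  linear_subspace S -> closed S -> adjoint (adjoint S) `<=` S.
Proof.
move=> Sl Sc; rewrite [X in _ `<=` X](closure_id S).1//.
exact: adjoint_sub_closure.
Qed.

End adjoint_density.

(** * Boundary triplets *)

(** The sign turns Green's formula of the triplet into its opposite, which
    cancels against the Lagrange form of the second summand in an exit space. *)
Definition boundary_value (R : realType) (V H : hilbertType R)
  (G0 G1 : V * V -> H) f : H * H := (G0 f, - G1 f).

Section boundary_triplet.
Context {R : realType} {V H : hilbertType R} {A : set (V * V)}.
Context {G0 G1 : V * V -> H}.
Hypothesis Asym : symmetric_relation A.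
Hypothesis Pi : ordinary_boundary_triplet A G0 G1.
Local Notation boundary_value := (boundary_value G0 G1).

Lemma boundary_value_linear a f g : adjoint A f -> adjoint A g ->
  boundary_value (a *: f + g) = a *: boundary_value f + boundary_value g.
Proof.
move=> Af Ag; rewrite /boundary_value.
rewrite (triplet_bounded0 Pi).1// (triplet_bounded1 Pi).1//.
by congr pair; rewrite /= scalerN opprD.
Qed.

Lemma boundary_value_surj h : exists2 f, adjoint A f & boundary_value f = h.
Proof.
case: h => h h'; have [f Af [f0 f1]] := triplet_surj Pi h (- h').
by exists f => //; rewrite /boundary_value f0 f1 opprK.
Qed.

Lemma lagrange_boundary_value f g : adjoint A f -> adjoint A g ->
  lagrange (boundary_value f) (boundary_value g) = - lagrange f g.
Proof.
move=> Af Ag; rewrite (triplet_green Pi)// {1}/lagrange /=.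
by rewrite linearNl linearNr /=; ring.
Qed.

(** [A] is in the kernel of the Lagrange form of [adjoint A], hence by
    surjectivity [boundary_value f] is in the kernel of that of [H * H]; tested
    against its own rotation, it gives minus its square norm. *)
Lemma boundary_value_eq0 f : A f -> boundary_value f = 0.
Proof.
move=> Af; have Aaf := Asym.2 _ Af.
have [g Ag gE] := boundary_value_surj (symplectic_rotation (boundary_value f)).
have : lagrange (boundary_value f) (boundary_value g) = 0.
  by rewrite lagrange_boundary_value// ((adjoint_lagrange _ _).1 Ag _ Af) oppr0.
rewrite lagrange_dot gE (_ : symplectic_rotation _ = - boundary_value f) //.
by rewrite linearNr => /eqP; rewrite oppr_eq0 dnorm_eq0 => /eqP.
Qed.

End boundary_triplet.

(** * Selfadjoint relations in the exit space *)

Section exit_space_extensions.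
Context {R : realType} {H1 H2 : hilbertType R}.
Local Notation C := R[i].
Implicit Types (A : set (H1 * H1)) (T : set ((H1 * H2) * (H1 * H2))).

Lemma oplusK (phi : (H1 * H2) * (H1 * H2)) :
  phi = oplus (phi.1.1, phi.2.1) (phi.1.2, phi.2.2).
Proof. by case: phi => -[? ?] []. Qed.

Lemma lagrange_oplus (f1 g1 : H1 * H1) (f2 g2 : H2 * H2) :
  lagrange (oplus f1 f2) (oplus g1 g2) = lagrange f1 g1 + lagrange f2 g2.
Proof. by rewrite /lagrange {1 2}/inner /= /prod_inner /=; ring. Qed.

Lemma second_projectionP T f2 :
  second_projection T f2 <-> exists f1, T (oplus f1 f2).
Proof.
split=> [[phi Tphi <-]|[f1 Tf]]; last first.
  by exists (oplus f1 f2); rewrite //= -surjective_pairing.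
by exists (phi.1.1, phi.2.1); rewrite -oplusK.
Qed.

Lemma extension_first_adjoint A T f1 f2 : T `<=` adjoint T ->
  (forall f, A f -> T (oplus f 0)) -> T (oplus f1 f2) -> adjoint A f1.
Proof.
move=> Tsym AT Tf; apply/adjoint_lagrange => f Af.
have := (adjoint_lagrange _ _).1 (Tsym _ Tf) _ (AT _ Af).
by rewrite lagrange_oplus [X in _ + X]/lagrange !linear0l subr0 addr0.
Qed.

Lemma second_part_adjoint T : selfadjoint_relation T ->
  second_part T = adjoint (second_projection T).
Proof.
move=> [Tl TE]; have l0 f1 : lagrange f1 (0 : H1 * H1) = 0.
  by rewrite /lagrange !linear0r subr0.
have Tsym : T `<=` adjoint T by rewrite -TE.
apply/seteqP; split=> g.
  move=> /Tsym/adjoint_lagrange Tg; apply/adjoint_lagrange => f2.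
  by move=> /second_projectionP[f1 /Tg]; rewrite lagrange_oplus l0 add0r.
move=> /adjoint_lagrange gT; rewrite /second_part /= TE.
apply/adjoint_lagrange => f Tf; rewrite [f]oplusK lagrange_oplus l0 add0r.
by apply: gT; exists f.
Qed.

Lemma second_projection_subspace T :
  linear_subspace T -> linear_subspace (second_projection T).
Proof.
move=> /linear_subspaceP[T0 TD]; apply/linear_subspaceP; split.
  by exists 0.
by move=> a _ _ [u Tu <-] [v Tv <-]; exists (a *: u + v); [exact: TD|].
Qed.

Lemma second_part_symmetric T : selfadjoint_relation T ->
  symmetric_relation (second_part T).
Proof.
move=> Tsa; rewrite second_part_adjoint//; split; first exact: adjoint_subspace.
rewrite -second_part_adjoint// {1}second_part_adjoint// => f Tf g Tg.
by apply: Tf; apply/second_projectionP; exists 0.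
Qed.

(** A vector [y] orthogonal to the eigenspaces at nonreal points makes [(0, y)]
    orthogonal to all resolvent vectors of the first summand: directly at nonreal
    points of the resolvent set, by [real_resolvent_limit] at real ones. *)
Lemma minimal_wrt_first_eigenspaces T :
  selfadjoint_relation T -> minimal_wrt_first T ->
  closure (linear_span (\bigcup_(l in [set l : C | l \isn't Num.real])
    eigenspace (second_projection T) l)) = [set: H2].
Proof.
move=> Tsa Tmin; apply: (dense_linear_span (hilbert_form_inner H2)) => y Ey.
suff /(congr1 snd) : (0, y) = 0 :> H1 * H2 by [].
apply: (orthogonal_dense (hilbert_form_prod_inner H1 H2) Tmin).
have pairy (v : H1 * H2) : inner v (0, y) = inner v.2 y.
  by rewrite {1}/inner /= /prod_inner /= linear0r add0r.
have eigen m (u z : H1 * H2) : first_summand u -> m \isn't Num.real ->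
    T (z, u + m *: z) -> inner z (0, y) = 0.
  move=> u0 mreal Tz; rewrite pairy; apply: Ey; exists m => //.
  by exists (z, u + m *: z) => //=; rewrite u0 add0r.
move=> _ [l lT [u u0 [v [u' u'0 /rel_resolventP Tv] <-]]].
rewrite linearDl [X in X + _]pairy u0 linear0l add0r.
have [lreal|] := boolP (l \is Num.real); last first.
  by move=> /eigen; apply; eassumption.
have [B _ TB] := lT.
have : rel_resolvent T l ((0, y), B (0, y)) by rewrite TB.
move=> /rel_resolventP Tw; apply: (real_resolvent_limit Tsa lreal Tv Tw).
by move=> m z; exact: eigen.
Qed.

End exit_space_extensions.

(** * The coupling of a triplet with a boundary relation *)

Section coupling.
Context {R : realType} {H1 H2 H : hilbertType R} {A : set (H1 * H1)}.
Context {G0 G1 : H1 * H1 -> H}.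
Local Notation C := R[i].
Hypothesis Asym : symmetric_relation A.
Hypothesis Pi : ordinary_boundary_triplet A G0 G1.
Local Notation bv := (boundary_value G0 G1).
Implicit Types (T : set ((H1 * H2) * (H1 * H2))) (S : set (H2 * H2)).
Implicit Types chi : set ((H2 * H2) * (H * H)).

Lemma relation_of_extensionP T f2 h :
  relation_of_extension A G0 G1 T (f2, h) <->
  exists f1, [/\ adjoint A f1, T (oplus f1 f2) & h = bv f1].
Proof.
split=> [[f1 [g2 [Tf Af _ [-> ->]]]]|[f1 [Af Tf ->]]]; first by exists f1.
by exists f1, f2; split=> //; apply/second_projectionP; exists f1.
Qed.

Lemma extension_of_relationP S chi f1 f2 : rel_dom chi `<=` adjoint S ->
  extension_of_relation A G0 G1 S chi (oplus f1 f2) <->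
  adjoint A f1 /\ chi (f2, bv f1).
Proof.
move=> chiS; split=> [[g1 [g2 [E Ag _ chig]]]|[Af chif]].
  have [-> ->] : f1 = g1 /\ f2 = g2; last by [].
  by case: f1 f2 g1 g2 E {Ag chig} => ? ? [? ?] [? ?] [? ?] [-> -> -> ->].
by exists f1, f2; split=> //; apply: chiS; exists (f2, bv f1).
Qed.

Lemma rel_dom_relation_of_extension T :
  (forall f1 f2, T (oplus f1 f2) -> adjoint A f1) ->
  rel_dom (relation_of_extension A G0 G1 T) = second_projection T.
Proof.
move=> TA; apply/seteqP; split=> f2.
  move=> [[g2 h] /relation_of_extensionP[f1 [_ Tf _]] <-].
  by apply/second_projectionP; exists f1.
move=> /second_projectionP[f1 Tf]; exists (f2, bv f1) => //.
by apply/relation_of_extensionP; exists f1; split=> //; exact: TA Tf.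
Qed.

(** For maximality, a pair [(g2, k)] that satisfies Green's identity lifts to
    [oplus g1 g2] with [boundary_value g1 = k]; the identity says that this
    vector is in [adjoint T], which is [T]. *)
Lemma relation_of_extension_boundary T :
  selfadjoint_relation T -> (forall f, A f -> T (oplus f 0)) ->
  boundary_relation (second_part T) (relation_of_extension A G0 G1 T).
Proof.
move=> Tsa AT; have [Tl TE] := Tsa.
have Tsym : T `<=` adjoint T by rewrite -TE.
have TA f1 f2 : T (oplus f1 f2) -> adjoint A f1.
  exact: extension_first_adjoint.
have [T0 TD] := (linear_subspaceP T).1 Tl.
have T2l := second_projection_subspace Tl.
have SE := second_part_adjoint Tsa.
split.
- exact: second_part_symmetric.
- by rewrite SE; exact: closed_adjoint.
- apply/linear_subspaceP; split.
    apply/relation_of_extensionP; exists 0.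
    have A0 := subspace0 Asym.1.
    by split=> //; [exact: Asym.2|rewrite (boundary_value_eq0 Asym Pi)].
  move=> a [u2 hu] [v2 hv] /relation_of_extensionP[u1 [Au Tu ->]].
  move=> /relation_of_extensionP[v1 [Av Tv ->]].
  apply/relation_of_extensionP; exists (a *: u1 + v1).
  rewrite (boundary_value_linear Pi)//; split=> //; last exact: TD Tu Tv.
  exact: ((linear_subspaceP _).1 (adjoint_subspace A)).2.
- rewrite rel_dom_relation_of_extension// SE.
  exact: sub_biadjoint.
- rewrite rel_dom_relation_of_extension//.
  by apply: adjoint_sub_closure => //; rewrite SE.
- move=> [f2 h] [g2 k] /relation_of_extensionP[f1 [Af Tf ->]].
  move=> /relation_of_extensionP[g1 [Ag Tg ->]] /=.
  rewrite (lagrange_boundary_value Pi)//; apply/eqP.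
  rewrite -addr_eq0 addrC -lagrange_oplus; apply/eqP.
  exact: ((adjoint_lagrange _ _).1 (Tsym _ Tg)).
- move=> [g2 k] Gg; have [g1 Ag gk] := boundary_value_surj Pi k.
  apply/relation_of_extensionP; exists g1; split=> //.
  rewrite TE; apply/adjoint_lagrange => phi Tphi.
  rewrite [phi]oplusK lagrange_oplus.
  set f1 := (phi.1.1, _); set f2 := (phi.1.2, _).
  have Tf : T (oplus f1 f2) by rewrite -oplusK.
  have Af := TA _ _ Tf.
  have := Gg (f2, bv f1); rewrite /= -gk (lagrange_boundary_value Pi)// => ->.
    exact: subrr.
  by apply/relation_of_extensionP; exists f1.
Qed.

Section extension.
Variables (S : set (H2 * H2)) (chi : set ((H2 * H2) * (H * H))).
Hypothesis chiB : boundary_relation S chi.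
Local Notation T := (extension_of_relation A G0 G1 S chi).

Let chi0 : chi 0.
Proof. exact: subspace0 (boundary_linear chiB). Qed.

Let TP f1 f2 : T (oplus f1 f2) <-> adjoint A f1 /\ chi (f2, bv f1).
Proof. exact/extension_of_relationP/(boundary_dom_sub chiB). Qed.

Lemma extension_of_relation_extends f : A f -> T (oplus f 0).
Proof.
move=> Af; apply/TP; split; first exact: Asym.2.
by rewrite (boundary_value_eq0 Asym Pi).
Qed.

(** An element [oplus g1 g2] of the adjoint has [g1] in [adjoint A] because
    [T] extends [A].  Lifting the boundary values shows that [(g2, bv g1)]
    satisfies Green's identity with all of [chi], hence is in [chi] by
    maximality. *)
Lemma extension_of_relation_selfadjoint : selfadjoint_relation T.
Proof.
suff TE : T = adjoint T by split=> //; rewrite TE; exact: adjoint_subspace.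
have Tsym : T `<=` adjoint T.
  move=> g; rewrite [g]oplusK => /TP[Ag chig]; apply/adjoint_lagrange => f.
  rewrite [f]oplusK => /TP[Af chif]; rewrite lagrange_oplus.
  have := boundary_green chiB chif chig.
  by rewrite /= (lagrange_boundary_value Pi)// => ->; exact: subrr.
apply/seteqP; split=> // g; rewrite [g]oplusK.
set g1 := (g.1.1, _); set g2 := (g.1.2, _) => /adjoint_lagrange Tg.
have Ag : adjoint A g1.
  apply/adjoint_lagrange => f /extension_of_relation_extends/Tg.
  by rewrite lagrange_oplus [X in _ + X]/lagrange !linear0l subr0 addr0.
apply/TP; split=> //; apply: (boundary_maximal chiB) => -[f2 h] chif /=.
have [f1 Af fh] := boundary_value_surj Pi h.
rewrite -fh (lagrange_boundary_value Pi)//; apply/eqP.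
rewrite -addr_eq0 addrC -lagrange_oplus; apply/eqP/Tg/TP.
by rewrite fh.
Qed.

(** The second part of [T] is the kernel of [chi], which by maximality is the
    adjoint of the domain of [chi]; the domain is dense in [adjoint S] and [S] is
    closed. *)
Lemma second_part_extension_of_relation : second_part T = S.
Proof.
have bv0 : bv 0 = 0.
  by apply: (boundary_value_eq0 Asym Pi); exact: subspace0 Asym.1.
have A0 : adjoint A 0 by exact: subspace0 (adjoint_subspace A).
have S_sym := boundary_base_symmetric chiB.
have l0 h : lagrange h (0 : H * H) = 0 by rewrite /lagrange !linear0r subr0.
apply/seteqP; split=> f2.
  move=> /TP[_]; rewrite bv0 => chif.
  apply: (biadjoint_closed S_sym.1 (boundary_base_closed chiB)).
  apply: (@adjointS _ _ _ _ (boundary_dom_dense chiB)).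
  apply: adjoint_closure; apply/adjoint_lagrange => _ [[g2 k] chig <-].
  by rewrite (boundary_green chiB chig chif) /= l0.
move=> Sf; apply/TP; rewrite bv0; split=> //.
apply: (boundary_maximal chiB) => p chip /=; rewrite l0.
apply: lagrange_eq0C; apply: ((adjoint_lagrange S _).1 _ _ Sf).
by apply: (boundary_dom_sub chiB); exists p.
Qed.

(** A vector [(x1, x2)] orthogonal to the first summand has [x1 = 0].  An
    eigenvector [f] of the domain of [chi] at [m] lifts to a pair of [T] with
    [(f1.1, f)] the resolvent at [m] of a vector of the first summand, so [x2]
    is orthogonal to [f]. *)
Lemma extension_of_relation_minimal :
  minimal_boundary_relation S chi -> minimal_wrt_first T.
Proof.
move=> [_ chimin]; apply: (dense_linear_span (hilbert_form_prod_inner H1 H2)).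
move=> [x1 x2] xT; have Tsa := extension_of_relation_selfadjoint.
have iC : ('i : C) \isn't Num.real.
  by apply/negP => /Creal_ImP; rewrite Im_i => /eqP; rewrite oner_eq0.
have Tres m u v : m \isn't Num.real -> T (v, u + m *: v) -> first_summand u ->
    inner v (x1, x2) = 0.
  move=> mreal Tv u0; apply: xT; exists m; first exact: selfadjoint_resolvent_set.
  exists 0 => //; exists v; last exact: add0r.
  by exists u => //; apply/rel_resolventP.
(* any point of the resolvent set will do, with resolvent vector [0] *)
have x10 : x1 = 0.
  apply/eqP; rewrite -(dnorm_eq0 inner); apply/eqP.
  have := xT (x1, 0); rewrite {1}/inner /= /prod_inner /= linear0l addr0; apply.
  exists 'i; first exact: selfadjoint_resolvent_set.
  exists (x1, 0) => //; exists 0; last exact: addr0.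
  exists 0 => //; apply/rel_resolventP; rewrite scaler0 addr0.
  exact: subspace0 Tsa.1.
congr pair => //; apply: (orthogonal_dense (hilbert_form_inner H2) chimin).
move=> f [m mreal [[g2 h] chig /= gE]].
have [f1 Af fh] := boundary_value_surj Pi h.
have Tf : T (oplus f1 g2) by apply/TP; rewrite fh.
have := @Tres m (f1.2 - m *: f1.1, 0) (f1.1, f) mreal.
rewrite x10 {1}/inner /= /prod_inner /= linear0r add0r; apply => //.
congr (T (_, _)): Tf; rewrite /= gE //=.
by congr pair; rewrite /= ?add0r// subrK.
Qed.

End extension.
End coupling.

Theorem theorem6p3 (R : realType) (H1 H : hilbertType R) (A : set (H1 * H1))
    (G0 G1 : H1 * H1 -> H)
    (Asym : symmetric_relation A) (Aclosed : closed A) (Aop : rel_operator A)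
    (Adefect : equal_defect_numbers A)
    (Pi : ordinary_boundary_triplet A G0 G1) :
  (forall (H2 : hilbertType R) (At : set ((H1 * H2) * (H1 * H2))),
     minimal_selfadjoint_extension A At ->
     minimal_boundary_relation (second_part At)
       (relation_of_extension A G0 G1 At))
  /\
  (forall (H2 : hilbertType R) (S2 : set (H2 * H2))
          (chi : set ((H2 * H2) * (H * H))),
     symmetric_relation S2 -> closed S2 -> rel_operator S2 ->
     simple_relation S2 ->
     minimal_boundary_relation S2 chi ->
     minimal_selfadjoint_extension A (extension_of_relation A G0 G1 S2 chi) /\
     second_part (extension_of_relation A G0 G1 S2 chi) = S2).
Proof.
split=> [H2 At [Tsa AT Tmin]|H2 S2 chi S2sym S2closed S2op S2simple chimin].
  have TA f1 f2 : At (oplus f1 f2) -> adjoint A f1.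
    by apply: extension_first_adjoint AT; rewrite -Tsa.2.
  split; first exact: relation_of_extension_boundary.
  rewrite rel_dom_relation_of_extension//.
  exact: minimal_wrt_first_eigenspaces.
have chiB := chimin.1.
split; last exact: (second_part_extension_of_relation Asym Pi chiB).
split; first exact: (extension_of_relation_selfadjoint Asym Pi chiB).
- by move=> f; exact: (extension_of_relation_extends Asym Pi chiB).
- exact: (extension_of_relation_minimal Asym Pi chiB).
Qed.
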